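(* For every integer $m\ge 0$ there exists $r_m>0$ such that for all $0<r<r_m$ the caustic of the iterate $R_r^{2m+1}$ has at least $4$ cusp points (counted as parameter values $\phi\in\mathbb{R}/2\pi\mathbb{Z}$).
   Context: Points of the unit circle $S^1\subset\mathbb{R}^2$ are written as $\phi \bmod 2\pi$, standing for $(\cos\phi,\sin\phi)$. For $0\le r<1$ the off-center reflection $R_r:S^1\to S^1$ is defined as follows: emit a ray from $(r,0)$ to $z\in S^1$, reflect it at $z$ in the circle (mirror reflection), and let $R_r(z)$ be the other point where the reflected ray meets $S^1$. Analytically, $R_r(\phi)=\phi+\pi-2\alpha(\phi) \pmod{2\pi}$ with $\alpha(\phi)=\operatorname{Arg}(\cos\phi-r+i\sin\phi)-\phi$ for $\phi\in(-\pi,\pi]$, where $\operatorname{Arg}$ takes values in $(-\pi,\pi]$. $R_r^n$ denotes the $n$-fold composition of $R_r$ with itself. Derivatives of circle maps are derivatives of their lifts to $\mathbb{R}$. The caustic of a smooth circle map $f:S^1\to S^1$ is the envelope of the family of lines joining $\phi$ to $f(\phi)$; it is the curve parametrized by $$x(\phi)=\frac{f'(\phi)\cos\phi+\cos f(\phi)}{1+f'(\phi)},\qquad y(\phi)=\frac{f'(\phi)\sin\phi+\sin f(\phi)}{1+f'(\phi)}.$$ A cusp point of the caustic is a parameter value $\phi$ at which $x'(\phi)=y'(\phi)=0$ and at which the tangent direction reverses (the one-sided limits of the unit velocity vector from the left and from the right are opposite). *)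

(* Defs.v *)
From Stdlib Require Import Reals Lra List.
From Coquelicot Require Import Coquelicot.

Open Scope R_scope.

Definition S1 : Type := {z : C | Cmod z = 1}.

Lemma Cmod_cos_sin (t : R) : Cmod (cos t, sin t) = 1.
Proof.
  unfold Cmod; simpl fst; simpl snd.
  replace (cos t ^ 2 + sin t ^ 2) with 1; [apply sqrt_1|].
  generalize (sin2_cos2 t); unfold Rsqr; lra.
Qed.

Definition circle_pt (t : R) : S1 := exist _ (cos t, sin t) (Cmod_cos_sin t).

(* Principal argument, with values in (-PI, PI]; see [Arg_spec].  Its value at
   z = 0 is arbitrary. *)
Definition Arg (z : C) : R :=
  if Rle_dec 0 (Im z) then acos (Re z / Cmod z) else - acos (Re z / Cmod z).

Definition alpha (r t : R) : R := Arg (cos t - r, sin t) - t.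

(* Off-center reflection: the angle of [z] is represented in (-PI, PI]. *)
Definition reflection (r : R) (z : S1) : S1 :=
  let t := Arg (proj1_sig z) in circle_pt (t + PI - 2 * alpha r t).

Definition smooth_lift (f : S1 -> S1) (F : R -> R) : Prop :=
  (forall n t, ex_derive_n F n t) /\
  (forall t, f (circle_pt t) = circle_pt (F t)).

Definition caustic_x (F : R -> R) (t : R) : R :=
  (Derive F t * cos t + cos (F t)) / (1 + Derive F t).

Definition caustic_y (F : R -> R) (t : R) : R :=
  (Derive F t * sin t + sin (F t)) / (1 + Derive F t).

Definition velocity (F : R -> R) (t : R) : C :=
  (Derive (caustic_x F) t, Derive (caustic_y F) t).

(* Equal to 0 where the velocity vanishes, so that convergence to a vector of
   modulus 1 forces the velocity to be nonzero near the limit point. *)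
Definition unit_velocity (F : R -> R) (t : R) : C :=
  let v := velocity F t in (fst v / Cmod v, snd v / Cmod v).

(* The condition 1 + F' <> 0 says that the caustic is defined at [t]. *)
Definition cusp_at (F : R -> R) (t : R) : Prop :=
  1 + Derive F t <> 0 /\
  is_derive (caustic_x F) t 0 /\
  is_derive (caustic_y F) t 0 /\
  exists u : C, Cmod u = 1 /\
    filterlim (unit_velocity F) (at_left t) (locally u) /\
    filterlim (unit_velocity F) (at_right t) (locally (Copp u)).

(* The parameter [z] stands for an angle modulo 2 PI.  Two lifts differ by a
   constant multiple of 2 PI and F (t + 2 PI) - F t is constant, so the choice
   of F and t is immaterial. *)
Definition is_cusp (f : S1 -> S1) (z : S1) : Prop :=
  exists (F : R -> R) (t : R),
    smooth_lift f F /\ circle_pt t = z /\ cusp_at F t.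

Lemma Cmod_sqr (z : C) : Cmod z * Cmod z = Re z * Re z + Im z * Im z.
Proof.
  unfold Cmod, Re, Im. rewrite sqrt_sqrt; [ring|nra].
Qed.

Lemma Arg_spec (z : C) : z <> RtoC 0 ->
  - PI < Arg z <= PI /\
  Re z = Cmod z * cos (Arg z) /\ Im z = Cmod z * sin (Arg z).
Proof.
  intros Hz. pose proof (proj1 (Cmod_gt_0 z) Hz) as Hp.
  pose proof (Cmod_sqr z) as Hs.
  set (q := Re z / Cmod z).
  assert (Hq : Re z = Cmod z * q) by (unfold q; field; lra).
  assert (Hi : Im z * Im z = (Cmod z * Cmod z) * (1 - q * q))
    by (rewrite Hq in Hs; lra).
  assert (Hq1 : q * q <= 1).
  { destruct (Rle_dec (q * q) 1) as [|H]; [assumption|].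
    assert (0 < (Cmod z * Cmod z) * (q * q - 1)) by (apply Rmult_lt_0_compat; nra).
    nra. }
  assert (Hb : -1 <= q <= 1) by nra.
  assert (Hr : sqrt (Im z * Im z) = Cmod z * sqrt (1 - q²)).
  { rewrite Hi, sqrt_mult by (unfold Rsqr; nra).
    rewrite sqrt_square by lra. reflexivity. }
  change (Im z * Im z) with (Rsqr (Im z)) in Hr. rewrite sqrt_Rsqr_abs in Hr.
  pose proof (acos_bound q) as Ha.
  unfold Arg; fold q. destruct (Rle_dec 0 (Im z)) as [H|H].
  - rewrite cos_acos, sin_acos, <- Hr, Rabs_pos_eq by assumption.
    pose proof PI_RGT_0. repeat split; lra.
  - rewrite cos_neg, sin_neg, cos_acos, sin_acos by assumption.
    rewrite Rabs_left in Hr by lra.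
    assert (acos q <> PI).
    { intros E. assert (Hc : q = -1) by (rewrite <- (cos_acos q Hb), E; apply cos_PI).
      rewrite Hc in Hi. nra. }
    repeat split; lra.
Qed.

(* The point [reflection r z] is the second intersection with the circle of the
   ray issued from [z] in the direction d - 2 <d, z> z obtained by mirror
   reflection from the incoming direction d = z - (r, 0). *)
Lemma reflection_geometric (r : R) (z : S1) : 0 <= r < 1 ->
  let x := Re (proj1_sig z) in let y := Im (proj1_sig z) in
  let p := (x - r) * x + y * y in
  exists s, 0 < s /\
    proj1_sig (reflection r z) =
      (x + s * (x - r - 2 * p * x), y + s * (y - 2 * p * y)).
Proof.
  intros Hr. destruct z as [z Hz]. intros x y p.
  change (proj1_sig _) with z in x, y.
  assert (Hz0 : z <> RtoC 0).
  { intros ->. rewrite Cmod_0 in Hz. lra. }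
  destruct (Arg_spec z Hz0) as (_ & Hx & Hy).
  rewrite Hz, Rmult_1_l in Hx, Hy. fold x in Hx; fold y in Hy.
  unfold reflection; cbn [proj1_sig]. set (t := Arg z) in *.
  unfold alpha. rewrite <- Hx, <- Hy.
  set (d := (x - r, y) : C).
  pose proof (Cmod_sqr z) as H1. rewrite Hz in H1. fold x y in H1.
  assert (Hp : 0 < p) by (unfold p; nra).
  assert (Hd0 : d <> RtoC 0).
  { intros E. pose proof (f_equal Re E) as E1. pose proof (f_equal Im E) as E2.
    change (x - r = 0) in E1. change (y = 0) in E2. unfold p in Hp. nra. }
  destruct (Arg_spec d Hd0) as (_ & Hdx & Hdy).
  pose proof (proj1 (Cmod_gt_0 d) Hd0) as HD. pose proof (Cmod_sqr d) as HDs.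
  set (D := Cmod d) in *. set (w := Arg d) in *.
  change (Re d) with (x - r) in *. change (Im d) with y in *.
  exists (2 * p / (D * D)). split.
  { apply Rdiv_lt_0_compat; nra. }
  replace (t + PI - 2 * (w - t)) with ((t - 2 * (w - t)) + PI) by ring.
  unfold circle_pt; cbn [proj1_sig]. rewrite neg_cos, neg_sin.
  rewrite cos_minus, sin_minus, cos_2a, sin_2a, cos_minus, sin_minus.
  rewrite <- Hx, <- Hy.
  assert (Hcw : cos w = (x - r) / D) by (rewrite Hdx; field; lra).
  assert (Hsw : sin w = y / D) by (rewrite Hdy at 1; field; lra).
  rewrite Hcw, Hsw.
  assert (HDD : D * D <> 0) by nra.
  assert (Hyy : y * y = 1 - x * x) by lra.
  assert (HD2 : D ^ 2 = 1 - 2 * r * x + r * r) by (simpl; rewrite Rmult_1_r; lra).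
  assert (y2 : y ^ 2 = 1 - x * x) by (rewrite <- Hyy; ring).
  assert (y3 : y ^ 3 = (1 - x * x) * y) by (rewrite <- Hyy; ring).
  assert (y4 : y ^ 4 = (1 - x * x) ^ 2) by (rewrite <- Hyy; ring).
  assert (y5 : y ^ 5 = (1 - x * x) ^ 2 * y) by (rewrite <- Hyy; ring).
  f_equal; apply (Rmult_eq_reg_r (D * D)); try assumption.
  - field_simplify; [|lra|lra]. unfold p. ring_simplify.
    rewrite ?HD2, ?y2, ?y4. ring.
  - field_simplify; [|lra|lra]. unfold p. ring_simplify.
    rewrite ?HD2, ?y3, ?y5. ring.
Qed.

(* Main.v *)
Require Import Defs.
From Stdlib Require Import Reals List.
From Coquelicot Require Import Coquelicot.
From Stdlib Require Import Lra Lia Nsatz ProofIrrelevance.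
Open Scope R_scope.

(* The k-th iterate has the explicit lift F_k = lift r k, with
   F_1(t) = t + pi - 2 atan (r sin t / (1 - r cos t)).  For odd k the velocity of
   the caustic is the chord e^{iF(t)} - e^{it} times a function with the sign of
     L = F' (1 + F') sin (F - t) - F'' (1 - cos (F - t)),
   so a sign change of L is a cusp.  By induction on m, for k = 2m + 1,
     F_k(t) - t - k pi = - 2 r sin t - (4m + 1) r^2 sin 2t + O(r^3)
   together with all t-derivatives.  The first order terms of L cancel and
     L = - 12 (2m + 1) r^2 sin 2t + O(r^3),
   with the corresponding expansion of its derivative.  Hence for small r there is
   a simple zero of L near each multiple of pi / 2. *)

(** * Families of functions whose t-derivatives are bounded uniformly in the parameter *)

(** The bound 1/2 keeps 1 - r cos p and the squared distance [dist2] away from 0 uniformly in p;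
    positivity allows division by r^2. *)
Definition small (r : R) : Prop := 0 < r < 1/2.

(** All derivatives are taken in t. The constants are uniform in both r and t, and no regularity in
    r is asked for. *)
Fixpoint bounded_derivs (n : nat) (f : R -> R -> R) : Prop :=
  (exists M, forall r t, small r -> Rabs (f r t) <= M) /\
  match n with
  | O => True
  | S k => (forall r t, small r -> ex_derive (f r) t) /\
           bounded_derivs k (fun r => Derive (f r))
  end.

Lemma bounded_derivs_0 n f : bounded_derivs n f ->
  exists M, forall r t, small r -> Rabs (f r t) <= M.
Proof. destruct n; intros [H _]; exact H. Qed.

Lemma bounded_derivs_pred n : forall f,
  bounded_derivs (S n) f -> bounded_derivs n f.
Proof.
  induction n as [|n IH]; intros f [H [Hd H']].
  - split; auto.
  - split; [exact H|]. split; [exact Hd|]. now apply IH.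
Qed.

Lemma bounded_derivs_ext n : forall f g,
  (forall r t, small r -> f r t = g r t) ->
  bounded_derivs n f -> bounded_derivs n g.
Proof.
  induction n as [|n IH]; intros f g E [[M HM] H].
  - split; [|trivial]. exists M. intros r t Hr. rewrite <- E by assumption. auto.
  - destruct H as [Hd H]. split; [|split].
    + exists M. intros r t Hr. rewrite <- E by assumption. auto.
    + intros r t Hr. apply ex_derive_ext with (f r); auto.
    + apply IH with (2 := H). intros r t Hr. apply Derive_ext. auto.
Qed.

Lemma bounded_derivs_is_derive n f f' :
  (forall r t, small r -> is_derive (f r) t (f' r t)) ->
  bounded_derivs (S n) f -> bounded_derivs n f'.
Proof.
  intros E [_ [_ H]]. apply bounded_derivs_ext with (2 := H).
  intros r t Hr. now apply is_derive_unique, E.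
Qed.

(** The introduction rule used below: it accepts a closed formula for the derivative in place of
    [Derive]. *)
Lemma bounded_derivs_S n f f' :
  (exists M, forall r t, small r -> Rabs (f r t) <= M) ->
  (forall r t, small r -> is_derive (f r) t (f' r t)) ->
  bounded_derivs n f' -> bounded_derivs (S n) f.
Proof.
  intros HM E H. split; [exact HM|split].
  - intros r t Hr. eexists. now apply E.
  - apply bounded_derivs_ext with (2 := H).
    intros r t Hr. symmetry. now apply is_derive_unique, E.
Qed.

Lemma bounded_derivs_plus n : forall f g,
  bounded_derivs n f -> bounded_derivs n g ->
  bounded_derivs n (fun r t => f r t + g r t).
Proof.
  assert (B : forall f g, bounded_derivs 0 f -> bounded_derivs 0 g ->
    exists M, forall r t, small r -> Rabs (f r t + g r t) <= M).
  { intros f g [[M HM] _] [[N HN] _]. exists (M + N). intros r t Hr.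
    eapply Rle_trans; [apply Rabs_triang|]. apply Rplus_le_compat; auto. }
  induction n as [|n IH]; intros f g Hf Hg.
  - split; auto.
  - destruct Hf as [Mf [Df Hf]], Hg as [Mg [Dg Hg]].
    apply bounded_derivs_S with (fun r t => Derive (f r) t + Derive (g r) t).
    + apply B; split; auto.
    + intros r t Hr. apply @is_derive_plus; apply Derive_correct; auto.
    + apply (IH (fun r => Derive (f r)) (fun r => Derive (g r))); auto.
Qed.

Lemma bounded_derivs_mult n : forall f g,
  bounded_derivs n f -> bounded_derivs n g ->
  bounded_derivs n (fun r t => f r t * g r t).
Proof.
  assert (B : forall f g, bounded_derivs 0 f -> bounded_derivs 0 g ->
    exists M, forall r t, small r -> Rabs (f r t * g r t) <= M).
  { intros f g [[M HM] _] [[N HN] _]. exists (M * N). intros r t Hr.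
    rewrite Rabs_mult. apply Rmult_le_compat; auto using Rabs_pos. }
  induction n as [|n IH]; intros f g Hf Hg.
  - split; auto.
  - pose proof (bounded_derivs_pred _ _ Hf) as Pf.
    pose proof (bounded_derivs_pred _ _ Hg) as Pg.
    destruct Hf as [Mf [Df Hf]], Hg as [Mg [Dg Hg]].
    apply bounded_derivs_S with
      (fun r t => Derive (f r) t * g r t + f r t * Derive (g r) t).
    + apply B; split; auto.
    + intros r t Hr. apply (is_derive_mult (f r) (g r));
        [apply Derive_correct; auto..|]. intros; apply Rmult_comm.
    + apply bounded_derivs_plus.
      * apply (IH (fun r => Derive (f r)) g); auto.
      * apply (IH f (fun r => Derive (g r))); auto.
Qed.

Lemma bounded_derivs_const n c : bounded_derivs n (fun _ _ => c).
Proof.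
  revert c; induction n as [|n IH]; intros c.
  - split; [exists (Rabs c); intros; lra | trivial].
  - apply bounded_derivs_S with (fun _ _ => 0);
      [|intros; apply (@is_derive_const R_AbsRing R_NormedModule)|apply IH].
    exists (Rabs c); intros; lra.
Qed.

Lemma bounded_derivs_param n : bounded_derivs n (fun r _ => r).
Proof.
  assert (B : exists M, forall r (t : R), small r -> Rabs r <= M).
  { exists 1. intros r _ [? ?]. rewrite Rabs_pos_eq; lra. }
  destruct n as [|n]; [split; auto|].
  apply bounded_derivs_S with (fun _ _ => 0);
    [exact B|intros; apply (@is_derive_const R_AbsRing R_NormedModule)
    |apply bounded_derivs_const].
Qed.

Lemma bounded_derivs_inv n f (d : R) : 0 < d ->
  (forall r t, small r -> d <= f r t) ->
  bounded_derivs n f -> bounded_derivs n (fun r t => / f r t).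
Proof.
  intros Hd Hf.
  assert (B : exists M, forall r t, small r -> Rabs (/ f r t) <= M).
  { exists (/ d). intros r t Hr. specialize (Hf r t Hr).
    rewrite Rabs_pos_eq by (left; apply Rinv_0_lt_compat; lra).
    apply Rinv_le_contravar; lra. }
  induction n as [|n IH]; intros H; [split; auto|].
  pose proof (bounded_derivs_pred _ _ H) as P. destruct H as [M [D H]].
  (* The derivative of [/ f] is written through [/ f] itself, so the induction hypothesis and the
     product rule give order n. *)
  apply bounded_derivs_S with
    (fun r t => -1 * (Derive (f r) t * (/ f r t * / f r t))).
  - exact B.
  - intros r t Hr. specialize (Hf r t Hr).
    replace (-1 * _) with (- Derive (f r) t / f r t ^ 2) by (field; lra).
    apply is_derive_inv; [apply Derive_correct; auto|lra].
  - apply (bounded_derivs_mult n (fun _ _ => -1)); [apply bounded_derivs_const|].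
    apply (bounded_derivs_mult n (fun r => Derive (f r))); [exact H|].
    apply bounded_derivs_mult; auto.
Qed.

Lemma bounded_derivs_cos_sin n :
  bounded_derivs n (fun _ t => cos t) /\ bounded_derivs n (fun _ t => sin t).
Proof.
  assert (Bc : exists M, forall (r t : R), small r -> Rabs (cos t) <= M).
  { exists 1. intros. apply Rabs_le. apply COS_bound. }
  assert (Bs : exists M, forall (r t : R), small r -> Rabs (sin t) <= M).
  { exists 1. intros. apply Rabs_le. apply SIN_bound. }
  induction n as [|n [IHc IHs]]; [repeat split; auto|split].
  - apply bounded_derivs_S with (fun _ t => -1 * sin t).
    + exact Bc.
    + intros. auto_derive; [trivial|ring].
    + apply (bounded_derivs_mult n (fun _ _ => -1)); auto using bounded_derivs_const.
  - apply bounded_derivs_S with (fun _ t => cos t); auto.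
    intros. auto_derive; [trivial|ring].
Qed.

(** Asking for every order makes the class closed under differentiation in t. *)
Definition nice (f : R -> R -> R) : Prop := forall n, bounded_derivs n f.

Lemma nice_ext f g :
  (forall r t, small r -> f r t = g r t) -> nice f -> nice g.
Proof. intros E H n. apply bounded_derivs_ext with (2 := H n). exact E. Qed.

Lemma nice_bound f : nice f -> exists M, forall r t, small r -> Rabs (f r t) <= M.
Proof. intros H. exact (bounded_derivs_0 _ _ (H O)). Qed.

Lemma nice_plus f g : nice f -> nice g -> nice (fun r t => f r t + g r t).
Proof. intros Hf Hg n. now apply bounded_derivs_plus. Qed.

Lemma nice_mult f g : nice f -> nice g -> nice (fun r t => f r t * g r t).
Proof. intros Hf Hg n. now apply bounded_derivs_mult. Qed.

Lemma nice_const c : nice (fun _ _ => c).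
Proof. intros n. apply bounded_derivs_const. Qed.

Lemma nice_param : nice (fun r _ => r).
Proof. intros n. apply bounded_derivs_param. Qed.

Lemma nice_minus f g : nice f -> nice g -> nice (fun r t => f r t - g r t).
Proof.
  intros Hf Hg.
  apply nice_ext with (fun r t => f r t + -1 * g r t); [intros; ring|].
  apply nice_plus; [exact Hf|].
  apply (nice_mult (fun _ _ => -1)); auto using nice_const.
Qed.

Lemma nice_opp f : nice f -> nice (fun r t => - f r t).
Proof.
  intros Hf.
  apply nice_ext with (fun r t => -1 * f r t); [intros; ring|].
  apply (nice_mult (fun _ _ => -1)); auto using nice_const.
Qed.

Lemma nice_is_derive f f' :
  (forall r t, small r -> is_derive (f r) t (f' r t)) -> nice f -> nice f'.
Proof. intros E H n. exact (bounded_derivs_is_derive n f f' E (H (S n))). Qed.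

Lemma nice_Derive f : nice f -> nice (fun r => Derive (f r)).
Proof. intros H n. destruct (H (S n)) as [_ [_ H']]. exact H'. Qed.

Lemma nice_ex_derive f : nice f -> forall r t, small r -> ex_derive (f r) t.
Proof. intros H. destruct (H (S O)) as [_ [H' _]]. exact H'. Qed.

Lemma nice_ex_derive_n n : forall f, nice f ->
  forall r t, small r -> ex_derive_n (f r) n t.
Proof.
  intros f Hf r t Hr.
  assert (E : forall k, exists g, nice g /\ forall x, Derive_n (f r) k x = g r x).
  { induction k as [|k [g [Hg E]]]; [now exists f|].
    exists (fun r => Derive (g r)). split; [now apply nice_Derive|].
    intros x. simpl. apply Derive_ext. exact E. }
  destruct n as [|k]; [exact I|]. simpl.
  destruct (E k) as [g [Hg Eg]].
  apply ex_derive_ext with (g r); [intros; symmetry; apply Eg|].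
  now apply nice_ex_derive.
Qed.

Ltac nice :=
  repeat first [assumption | apply nice_const | apply nice_param
    | apply nice_plus | apply nice_minus | apply nice_opp | apply nice_mult].

(** * Calculus of second order expansions in r *)

(* Second order Taylor expansion in the parameter, whose remainder may be
   differentiated in t. *)
Definition jet (f : R -> R -> R) (a0 a1 a2 : R -> R) : Prop :=
  nice (fun _ t => a0 t) /\ nice (fun _ t => a1 t) /\ nice (fun _ t => a2 t) /\
  exists h, nice h /\ forall r t, small r ->
    f r t = a0 t + r * a1 t + r ^ 2 * a2 t + r ^ 3 * h r t.

Lemma jet_nice f a0 a1 a2 : jet f a0 a1 a2 -> nice f.
Proof.
  intros (H0 & H1 & H2 & h & Hh & E).
  apply nice_ext with (fun r t => a0 t + r * a1 t + r * r * a2 t + r * r * r * h r t).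
  - intros r t Hr. rewrite E by assumption. ring.
  - nice.
Qed.

Lemma jet_ext f g a0 a1 a2 b0 b1 b2 :
  jet f a0 a1 a2 -> (forall r t, small r -> f r t = g r t) ->
  (forall t, a0 t = b0 t) -> (forall t, a1 t = b1 t) -> (forall t, a2 t = b2 t) ->
  jet g b0 b1 b2.
Proof.
  intros (H0 & H1 & H2 & h & Hh & E) Ef E0 E1 E2.
  split; [|split; [|split]].
  - apply nice_ext with (2 := H0); auto.
  - apply nice_ext with (2 := H1); auto.
  - apply nice_ext with (2 := H2); auto.
  - exists h. split; [exact Hh|]. intros r t Hr.
    rewrite <- Ef, <- E0, <- E1, <- E2 by assumption. auto.
Qed.

Lemma jet_coef a : nice (fun _ t => a t) ->
  jet (fun _ t => a t) a (fun _ => 0) (fun _ => 0).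
Proof.
  intros H. repeat split; [exact H|apply nice_const..|].
  exists (fun _ _ => 0). split; [apply nice_const|]. intros; ring.
Qed.

Lemma jet_const c : jet (fun _ _ => c) (fun _ => c) (fun _ => 0) (fun _ => 0).
Proof. apply (jet_coef (fun _ => c)). apply nice_const. Qed.

Lemma jet_param : jet (fun r _ => r) (fun _ => 0) (fun _ => 1) (fun _ => 0).
Proof.
  repeat split; [apply nice_const..|].
  exists (fun _ _ => 0). split; [apply nice_const|]. intros; ring.
Qed.

Lemma jet_plus f g a0 a1 a2 b0 b1 b2 :
  jet f a0 a1 a2 -> jet g b0 b1 b2 ->
  jet (fun r t => f r t + g r t)
    (fun t => a0 t + b0 t) (fun t => a1 t + b1 t) (fun t => a2 t + b2 t).
Proof.
  intros (H0 & H1 & H2 & h & Hh & E) (K0 & K1 & K2 & k & Hk & E').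
  repeat split; [nice..|].
  exists (fun r t => h r t + k r t). split; [nice|].
  intros r t Hr. rewrite E, E' by assumption. ring.
Qed.

Lemma jet_mult f g a0 a1 a2 b0 b1 b2 :
  jet f a0 a1 a2 -> jet g b0 b1 b2 ->
  jet (fun r t => f r t * g r t)
    (fun t => a0 t * b0 t) (fun t => a0 t * b1 t + a1 t * b0 t)
    (fun t => a0 t * b2 t + a1 t * b1 t + a2 t * b0 t).
Proof.
  intros Hf Hg. pose proof (jet_nice _ _ _ _ Hg) as Ng.
  destruct Hf as (H0 & H1 & H2 & h & Hh & E), Hg as (K0 & K1 & K2 & k & Hk & E').
  repeat split; [nice..|].
  (* Write f g as (a0 + r a1 + r^2 a2) g + r^3 h g; in each r^i a_i g only the part of g of degree
     at least 3 - i goes to the remainder. *)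
  exists (fun r t => h r t * g r t + a0 t * k r t + a1 t * (b2 t + r * k r t)
                     + a2 t * (b1 t + r * b2 t + r * r * k r t)).
  split; [nice|].
  intros r t Hr. rewrite E, E' by assumption. ring.
Qed.

Lemma jet_minus f g a0 a1 a2 b0 b1 b2 :
  jet f a0 a1 a2 -> jet g b0 b1 b2 ->
  jet (fun r t => f r t - g r t)
    (fun t => a0 t - b0 t) (fun t => a1 t - b1 t) (fun t => a2 t - b2 t).
Proof.
  intros Hf Hg.
  refine (jet_ext _ _ _ _ _ _ _ _
    (jet_plus _ _ _ _ _ _ _ _ Hf
      (jet_mult _ _ _ _ _ _ _ _ (jet_const (-1)) Hg)) _ _ _ _);
    intros; simpl; ring.
Qed.

Lemma jet_inv f a0 a1 a2 (d : R) : 0 < d ->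
  (forall r t, small r -> d <= f r t) -> (forall t, a0 t = 1) ->
  jet f a0 a1 a2 ->
  jet (fun r t => / f r t) (fun _ => 1) (fun t => - a1 t)
    (fun t => a1 t * a1 t - a2 t).
Proof.
  intros Hd Hf E0 Hj. pose proof (jet_nice _ _ _ _ Hj) as Nf.
  destruct Hj as (H0 & H1 & H2 & h & Hh & E).
  assert (Ni : nice (fun r t => / f r t)).
  { intros n. apply bounded_derivs_inv with d; auto. }
  repeat split; [nice..|].
  (* With p = 1 - r a1 + r^2 (a1^2 - a2), the remainder is (1 - f p) / (r^3 f), expanded so that r^3
     cancels. *)
  exists (fun r t =>
    (a1 t * (a2 t - (a1 t * a1 t - a2 t)) - r * (a2 t * (a1 t * a1 t - a2 t))
     - h r t * (1 - r * a1 t + r * r * (a1 t * a1 t - a2 t))) * / f r t).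
  split; [nice|].
  intros r t Hr. pose proof (Hf r t Hr) as P.
  apply (Rmult_eq_reg_r (f r t)); [|lra].
  rewrite Rinv_l by lra. field_simplify; [|lra].
  rewrite !E, !E0 by assumption. ring.
Qed.

(** Termwise differentiation is legitimate because the remainder is [nice]: its t-derivative is
    [nice] too and keeps the factor r^3. *)
Lemma jet_is_derive f f' a0 a1 a2 b0 b1 b2 :
  jet f a0 a1 a2 ->
  (forall r t, small r -> is_derive (f r) t (f' r t)) ->
  (forall t, is_derive a0 t (b0 t)) -> (forall t, is_derive a1 t (b1 t)) ->
  (forall t, is_derive a2 t (b2 t)) ->
  jet f' b0 b1 b2.
Proof.
  intros (H0 & H1 & H2 & h & Hh & E) Df D0 D1 D2.
  split; [|split; [|split]].
  - apply nice_is_derive with (2 := H0); auto.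
  - apply nice_is_derive with (2 := H1); auto.
  - apply nice_is_derive with (2 := H2); auto.
  - exists (fun r => Derive (h r)). split; [now apply nice_Derive|].
    intros r t Hr. rewrite <- (is_derive_unique _ _ _ (Df r t Hr)).
    rewrite (Derive_ext _ _ t (fun x => E r x Hr)).
    apply is_derive_unique.
    pose proof (nice_ex_derive h Hh r t Hr) as Dh.
    pose proof (D0 t); pose proof (D1 t); pose proof (D2 t).
    auto_derive.
    + repeat split; try assumption; eexists; eauto.
    + change (Derive (fun x => h r x) t) with (Derive (h r) t).
      replace (Derive (fun x => a0 x) t) with (b0 t)
        by (symmetry; now apply is_derive_unique).
      replace (Derive (fun x => a1 x) t) with (b1 t)
        by (symmetry; now apply is_derive_unique).
      replace (Derive (fun x => a2 x) t) with (b2 t)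
        by (symmetry; now apply is_derive_unique).
      ring.
Qed.

(** This lemma and the next turn expansions into estimates uniform in t, from which the threshold on
    r is chosen. *)
Lemma jet_bound_0 f a0 a1 a2 : jet f a0 a1 a2 ->
  exists M, forall r t, small r -> Rabs (f r t - a0 t) <= M * r.
Proof.
  intros (H0 & H1 & H2 & h & Hh & E).
  assert (N : nice (fun r t => a1 t + r * a2 t + r * r * h r t)) by nice.
  destruct (nice_bound _ N) as [M HM]. exists M. intros r t Hr.
  rewrite E by assumption.
  replace (_ - _) with ((a1 t + r * a2 t + r * r * h r t) * r) by ring.
  rewrite Rabs_mult, (Rabs_pos_eq r) by (destruct Hr; lra).
  apply Rmult_le_compat_r; [destruct Hr; lra|]. auto.
Qed.

Lemma jet_bound_2 f a2 : jet f (fun _ => 0) (fun _ => 0) a2 ->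
  exists M, forall r t, small r -> Rabs (f r t / r ^ 2 - a2 t) <= M * r.
Proof.
  intros (H0 & H1 & H2 & h & Hh & E).
  destruct (nice_bound _ Hh) as [M HM]. exists M. intros r t Hr.
  rewrite E by assumption. destruct Hr as [Hr Hr'].
  replace (_ - _) with (h r t * r) by (field; lra).
  rewrite Rabs_mult, (Rabs_pos_eq r) by lra.
  apply Rmult_le_compat_r; [lra|]. apply HM. now split.
Qed.

(** * The explicit lift of the reflection and of its iterates *)

(** Modulo 2 pi, the angle alpha is the argument of e^{-ip} (e^{ip} - r) = (1 - r cos p) + i r sin
    p. For [small r] the real part is positive, so [atan] gives this argument smoothly for all real
    p, without the jumps of [Arg]. *)
Definition half_turn (r p : R) : R := atan (r * sin p / (1 - r * cos p)).

Definition lift_step (r p : R) : R := p + PI - 2 * half_turn r p.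

Fixpoint lift (r : R) (k : nat) (t : R) : R :=
  match k with
  | O => t
  | S j => lift_step r (lift r j t)
  end.

(** The squared distance from the source (r, 0) to the point of angle p. *)
Definition dist2 (r p : R) : R := 1 - 2 * (r * cos p) + r * r.

Lemma dist2_ge r p : small r -> / 4 <= dist2 r p.
Proof. intros [H0 H1]. unfold dist2. pose proof (COS_bound p). nra. Qed.

Lemma one_minus_cos_pos r p : small r -> 0 < 1 - r * cos p.
Proof. intros [H0 H1]. pose proof (COS_bound p). nra. Qed.

Lemma cos_sin_2atan y :
  cos (2 * atan y) = 1 - 2 * y ^ 2 / (1 + y ^ 2) /\
  sin (2 * atan y) = 2 * y / (1 + y ^ 2).
Proof.
  rewrite cos_2a_sin, sin_2a, sin_atan, cos_atan.
  assert (P : 0 < 1 + y²) by (unfold Rsqr; nra).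
  pose proof (sqrt_lt_R0 _ P) as Q. pose proof (sqrt_sqrt _ (Rlt_le _ _ P)) as E.
  set (s := sqrt (1 + y²)) in *.
  replace (1 + y ^ 2) with (s * s) by (rewrite E; unfold Rsqr; ring).
  split; field; lra.
Qed.

(** Doubling the angle removes both [atan] and square roots: what remains is rational in r, cos p
    and sin p, so the expansions below need only products and one inverse. *)
Lemma cos_sin_half_turn r p : small r ->
  cos (2 * half_turn r p) = 1 - 2 * (r * sin p) ^ 2 * / dist2 r p /\
  sin (2 * half_turn r p) = 2 * (r * sin p) * (1 - r * cos p) * / dist2 r p.
Proof.
  intros Hr. unfold half_turn.
  pose proof (one_minus_cos_pos r p Hr) as P. pose proof (dist2_ge r p Hr) as D.
  set (y := r * sin p / (1 - r * cos p)).
  assert (E : 1 + y ^ 2 = dist2 r p / (1 - r * cos p) ^ 2).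
  { replace (dist2 r p) with ((1 - r * cos p) ^ 2 + (r * sin p) ^ 2).
    - unfold y. field. lra.
    - unfold dist2. pose proof (sin2_cos2 p) as T. unfold Rsqr in T. nra. }
  destruct (cos_sin_2atan y) as [-> ->]. rewrite E. unfold y.
  split; field; lra.
Qed.

Lemma S1_eq (z w : S1) : proj1_sig z = proj1_sig w -> z = w.
Proof.
  destruct z as [z Hz], w as [w Hw]; simpl; intros ->.
  f_equal. apply proof_irrelevance.
Qed.

Lemma circle_pt_eq a b : circle_pt a = circle_pt b <-> cos a = cos b /\ sin a = sin b.
Proof.
  split.
  - intros E. apply (f_equal (@proj1_sig _ _)) in E. simpl in E.
    injection E; auto.
  - intros [H1 H2]. apply S1_eq. simpl. now rewrite H1, H2.
Qed.

Lemma circle_pt_Arg (z : S1) : circle_pt (Arg (proj1_sig z)) = z.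
Proof.
  apply S1_eq. destruct z as [z Hz]. simpl.
  assert (Hz0 : z <> RtoC 0) by (intros ->; rewrite Cmod_0 in Hz; lra).
  destruct (Arg_spec z Hz0) as (_ & Hx & Hy).
  rewrite Hz, Rmult_1_l in Hx, Hy. rewrite <- Hx, <- Hy. now destruct z.
Qed.

(** The principal angle [a] may differ from [p], and [alpha r a] from [half_turn r p], by multiples
    of 2 pi. Hence only cosines and sines are compared, through (e^{ip} - r) e^{-ip}. *)
Lemma reflection_lift r p : small r ->
  reflection r (circle_pt p) = circle_pt (lift_step r p).
Proof.
  intros Hr. unfold reflection. cbv zeta.
  pose proof (circle_pt_Arg (circle_pt p)) as Ea.
  set (a := Arg (proj1_sig (circle_pt p))) in *.
  apply circle_pt_eq in Ea. destruct Ea as [Ec Es].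
  destruct (cos_sin_half_turn r p Hr) as [Hc Hs].
  pose proof (dist2_ge r p Hr) as D. pose proof (one_minus_cos_pos r p Hr) as P.
  pose proof (sin2_cos2 p) as T. unfold Rsqr in T.
  set (w := (cos a - r, sin a) : C).
  assert (M : Cmod w * Cmod w = dist2 r p).
  { rewrite Cmod_sqr. unfold w, dist2; simpl. rewrite Ec, Es. lra. }
  assert (W : w <> RtoC 0).
  { intros E. rewrite E, Cmod_0 in M. lra. }
  destruct (Arg_spec w W) as (_ & Hx & Hy).
  pose proof (proj1 (Cmod_gt_0 w) W) as N.
  change (Re w) with (cos a - r) in Hx. change (Im w) with (sin a) in Hy.
  assert (Al : alpha r a = Arg w - a) by reflexivity.
  set (m := Cmod w) in *.
  rewrite Ec in Hx; rewrite Es in Hy.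
  assert (Cw : cos (Arg w) = (cos p - r) / m) by (rewrite Hx; field; lra).
  assert (Sw : sin (Arg w) = sin p / m) by (rewrite Hy; field; lra).
  assert (Ca : cos (alpha r a) = (1 - r * cos p) / m).
  { rewrite Al, cos_minus, Ec, Es, Cw, Sw, <- T. field. lra. }
  assert (Sa : sin (alpha r a) = r * sin p / m).
  { rewrite Al, sin_minus, Ec, Es, Cw, Sw. field. lra. }
  assert (C2 : cos (2 * alpha r a) = cos (2 * half_turn r p)).
  { rewrite cos_2a_sin, Sa, Hc, <- M. field. lra. }
  assert (S2 : sin (2 * alpha r a) = sin (2 * half_turn r p)).
  { rewrite sin_2a, Ca, Sa, Hs, <- M. field. lra. }
  apply circle_pt_eq. unfold lift_step.
  rewrite !cos_minus, !sin_minus, !neg_cos, !neg_sin, C2, S2, Ec, Es. auto.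
Qed.

Lemma iter_reflection_lift r k t : small r ->
  Nat.iter k (reflection r) (circle_pt t) = circle_pt (lift r k t).
Proof.
  intros Hr. induction k as [|k IH]; [reflexivity|].
  simpl. rewrite IH. now apply reflection_lift.
Qed.

Lemma ex_derive_lift r k t : small r -> ex_derive (lift r k) t.
Proof.
  intros Hr. revert t. induction k as [|k IH]; intros t; simpl.
  - apply ex_derive_id.
  - unfold lift_step, half_turn.
    pose proof (one_minus_cos_pos r (lift r k t) Hr) as P.
    specialize (IH t). auto_derive. repeat split; try assumption; try lra.
Qed.

(** * Expansion of the displacement of the iterates *)

(** The displacement F_k(t) - t is handled through its cosine and sine, which obey a rational
    recursion in k. *)
Definition shift_cos (k : nat) (r t : R) : R := cos (lift r k t - t).
Definition shift_sin (k : nat) (r t : R) : R := sin (lift r k t - t).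

Lemma jet_cos : jet (fun _ t => cos t) cos (fun _ => 0) (fun _ => 0).
Proof. apply jet_coef. intros n; apply bounded_derivs_cos_sin. Qed.

Lemma jet_sin : jet (fun _ t => sin t) sin (fun _ => 0) (fun _ => 0).
Proof. apply jet_coef. intros n; apply bounded_derivs_cos_sin. Qed.

Lemma cos_lift k r t :
  cos (lift r k t) = cos t * shift_cos k r t - sin t * shift_sin k r t.
Proof.
  unfold shift_cos, shift_sin. rewrite <- cos_plus. f_equal; ring.
Qed.

Lemma sin_lift k r t :
  sin (lift r k t) = sin t * shift_cos k r t + cos t * shift_sin k r t.
Proof.
  unfold shift_cos, shift_sin. rewrite <- sin_plus. f_equal; ring.
Qed.

(** One more reflection adds pi - 2 [half_turn] to the displacement; this is the angle addition
    formula combined with [cos_sin_half_turn]. *)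
Lemma shift_S k r t : small r ->
  let s := r * sin (lift r k t) in
  let c := r * cos (lift r k t) in
  let q := / dist2 r (lift r k t) in
  shift_cos (S k) r t =
    2 * (s * s * q) * shift_cos k r t - shift_cos k r t
    - 2 * (s * (1 - c) * q) * shift_sin k r t /\
  shift_sin (S k) r t =
    2 * (s * s * q) * shift_sin k r t - shift_sin k r t
    + 2 * (s * (1 - c) * q) * shift_cos k r t.
Proof.
  intros Hr s c q. destruct (cos_sin_half_turn r (lift r k t) Hr) as [Hc Hs].
  unfold shift_cos, shift_sin. simpl lift. unfold lift_step.
  set (p := lift r k t) in *.
  replace (p + PI - 2 * half_turn r p - t)
    with ((p - t) - 2 * half_turn r p + PI) by ring.
  rewrite neg_cos, neg_sin, cos_minus, (sin_minus (p - t)), Hc, Hs.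
  fold q s c. split; ring.
Qed.

(** Here [c0], [s0] are the constant coefficients of cos and sin of the lift, and [s1] is the
    coefficient of r in the sine. With s, c, q as in [shift_S], the product s (1 - c) q has the
    expansion r [s0] + r^2 [u], where q = 1 + 2 r [c0] + O(r^2). *)
Lemma jet_shift_S k x0 x1 x2 y0 y1 y2 :
  jet (shift_cos k) x0 x1 x2 -> jet (shift_sin k) y0 y1 y2 ->
  let c0 t := cos t * x0 t - sin t * y0 t in
  let s0 t := sin t * x0 t + cos t * y0 t in
  let s1 t := sin t * x1 t + cos t * y1 t in
  let u t := s1 t + s0 t * c0 t in
  jet (shift_cos (S k))
    (fun t => - x0 t)
    (fun t => - x1 t - 2 * s0 t * y0 t)
    (fun t => - x2 t + 2 * s0 t ^ 2 * x0 t - 2 * (s0 t * y1 t + u t * y0 t)) /\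
  jet (shift_sin (S k))
    (fun t => - y0 t)
    (fun t => - y1 t + 2 * s0 t * x0 t)
    (fun t => - y2 t + 2 * s0 t ^ 2 * y0 t + 2 * (s0 t * x1 t + u t * x0 t)).
Proof.
  intros JC JS c0 s0 s1 u.
  pose proof (jet_minus _ _ _ _ _ _ _ _
    (jet_mult _ _ _ _ _ _ _ _ jet_cos JC)
    (jet_mult _ _ _ _ _ _ _ _ jet_sin JS)) as Jc.
  pose proof (jet_plus _ _ _ _ _ _ _ _
    (jet_mult _ _ _ _ _ _ _ _ jet_sin JC)
    (jet_mult _ _ _ _ _ _ _ _ jet_cos JS)) as Js.
  pose proof (jet_mult _ _ _ _ _ _ _ _ jet_param Jc) as Jrc.
  pose proof (jet_mult _ _ _ _ _ _ _ _ jet_param Js) as Jrs.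
  pose proof (jet_plus _ _ _ _ _ _ _ _
    (jet_minus _ _ _ _ _ _ _ _ (jet_const 1)
      (jet_mult _ _ _ _ _ _ _ _ (jet_const 2) Jrc))
    (jet_mult _ _ _ _ _ _ _ _ jet_param jet_param)) as Jd.
  (* [Jd] expands [dist2] at the lift; /4 is the lower bound from [dist2_ge], and the constant term
     is 1 as [jet_inv] requires. *)
  pose proof (fun H1 H2 => jet_inv _ _ _ _ (/4) ltac:(lra) H1 H2 Jd) as Jq.
  simpl in Jq.
  specialize (Jq ltac:(intros r t Hr; rewrite <- cos_lift; apply (dist2_ge r _ Hr))
    ltac:(intros; ring)).
  pose proof (jet_mult _ _ _ _ _ _ _ _
    (jet_const 2) (jet_mult _ _ _ _ _ _ _ _
      (jet_mult _ _ _ _ _ _ _ _ Jrs Jrs) Jq)) as Ja.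
  pose proof (jet_mult _ _ _ _ _ _ _ _
    (jet_const 2) (jet_mult _ _ _ _ _ _ _ _
      (jet_mult _ _ _ _ _ _ _ _ Jrs
        (jet_minus _ _ _ _ _ _ _ _ (jet_const 1) Jrc)) Jq)) as Jb.
  split.
  - refine (jet_ext _ _ _ _ _ _ _ _
      (jet_minus _ _ _ _ _ _ _ _
        (jet_minus _ _ _ _ _ _ _ _ (jet_mult _ _ _ _ _ _ _ _ Ja JC) JC)
        (jet_mult _ _ _ _ _ _ _ _ Jb JS)) _ _ _ _).
    + intros r t Hr. destruct (shift_S k r t Hr) as [-> _].
      unfold dist2. rewrite cos_lift, sin_lift. reflexivity.
    + intros; cbv beta; ring.
    + intros; unfold s0; cbv beta; ring.
    + intros; unfold u, s1, c0, s0; cbv beta; ring.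
  - refine (jet_ext _ _ _ _ _ _ _ _
      (jet_plus _ _ _ _ _ _ _ _
        (jet_minus _ _ _ _ _ _ _ _ (jet_mult _ _ _ _ _ _ _ _ Ja JS) JS)
        (jet_mult _ _ _ _ _ _ _ _ Jb JC)) _ _ _ _).
    + intros r t Hr. destruct (shift_S k r t Hr) as [_ ->].
      unfold dist2. rewrite cos_lift, sin_lift. reflexivity.
    + intros; cbv beta; ring.
    + intros; unfold s0; cbv beta; ring.
    + intros; unfold u, s1, c0, s0; cbv beta; ring.
Qed.

Lemma jet_shift_odd_of_even m :
  jet (shift_cos (2 * m)) (fun _ => 1) (fun _ => 0) (fun _ => 0) ->
  jet (shift_sin (2 * m)) (fun _ => 0) (fun _ => 0)
    (fun t => - 8 * INR m * (sin t * cos t)) ->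
  jet (shift_cos (2 * m + 1)) (fun _ => -1) (fun _ => 0)
    (fun t => 2 * sin t ^ 2) /\
  jet (shift_sin (2 * m + 1)) (fun _ => 0) (fun t => 2 * sin t)
    (fun t => (8 * INR m + 2) * (sin t * cos t)).
Proof.
  intros JC JS. rewrite Nat.add_1_r.
  destruct (jet_shift_S _ _ _ _ _ _ _ JC JS) as [HC HS].
  split; [refine (jet_ext _ _ _ _ _ _ _ _ HC _ _ _ _)
         |refine (jet_ext _ _ _ _ _ _ _ _ HS _ _ _ _)];
  intros; cbv beta zeta; try reflexivity; ring.
Qed.

(** Over two reflections the terms of order r cancel, and each pair adds - 4 r^2 sin 2t to the
    displacement; hence the coefficient linear in m. The induction passes through the odd iterate 2m
    + 1. *)
Lemma jet_shift_even m :
  jet (shift_cos (2 * m)) (fun _ => 1) (fun _ => 0) (fun _ => 0) /\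
  jet (shift_sin (2 * m)) (fun _ => 0) (fun _ => 0)
    (fun t => - 8 * INR m * (sin t * cos t)).
Proof.
  induction m as [|m [IC IS]].
  - split.
    + refine (jet_ext _ _ _ _ _ _ _ _ (jet_const 1) _ _ _ _); intros; try reflexivity.
      unfold shift_cos; simpl. now rewrite Rminus_diag, cos_0.
    + refine (jet_ext _ _ _ _ _ _ _ _ (jet_const 0) _ _ _ _); intros;
        try reflexivity; simpl; try ring.
      unfold shift_sin; simpl. now rewrite Rminus_diag, sin_0.
  - destruct (jet_shift_odd_of_even m IC IS) as [JC JS].
    replace (2 * S m)%nat with (S (2 * m + 1)) by lia. rewrite S_INR.
    destruct (jet_shift_S _ _ _ _ _ _ _ JC JS) as [HC HS].
    split; [refine (jet_ext _ _ _ _ _ _ _ _ HC _ _ _ _)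
           |refine (jet_ext _ _ _ _ _ _ _ _ HS _ _ _ _)];
    intros; cbv beta zeta; try reflexivity; ring.
Qed.

Lemma jet_shift_odd m :
  jet (shift_cos (2 * m + 1)) (fun _ => -1) (fun _ => 0)
    (fun t => 2 * sin t ^ 2) /\
  jet (shift_sin (2 * m + 1)) (fun _ => 0) (fun t => 2 * sin t)
    (fun t => (8 * INR m + 2) * (sin t * cos t)).
Proof. destruct (jet_shift_even m). now apply jet_shift_odd_of_even. Qed.

(** * Expansions of the derivatives of the lift and of L *)

Definition speed (k : nat) (r t : R) : R := Derive (lift r k) t.
Definition accel (k : nat) (r t : R) : R := Derive (speed k r) t.

Lemma is_derive_lift k r t : small r -> is_derive (lift r k) t (speed k r t).
Proof. intros Hr. now apply Derive_correct, ex_derive_lift. Qed.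

Lemma is_derive_shift k r t : small r ->
  is_derive (shift_cos k r) t (- shift_sin k r t * (speed k r t - 1)) /\
  is_derive (shift_sin k r) t (shift_cos k r t * (speed k r t - 1)).
Proof.
  intros Hr. pose proof (ex_derive_lift r k t Hr) as D.
  unfold shift_cos, shift_sin, speed.
  split; auto_derive; auto;
    change (Derive (fun x => lift r k x)) with (Derive (lift r k));
    unfold Rminus; ring.
Qed.

(** With c, s the cosine and sine of the displacement, c s' - s c' = (c^2 + s^2) (F' - 1) = F' - 1.
    So F' is expanded from the jets of c and s and their termwise derivatives. *)
Lemma jet_speed m :
  jet (speed (2 * m + 1)) (fun _ => 1) (fun t => - 2 * cos t)
    (fun t => - (8 * INR m + 2) * (cos t ^ 2 - sin t ^ 2)).
Proof.
  set (k := (2 * m + 1)%nat). destruct (jet_shift_odd m) as [JC JS].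
  fold k in JC, JS.
  assert (JC' : jet (fun r t => - shift_sin k r t * (speed k r t - 1))
    (fun _ => 0) (fun _ => 0) (fun t => 4 * (sin t * cos t))).
  { apply (jet_is_derive _ _ _ _ _ _ _ _ JC).
    - intros r t Hr. now apply is_derive_shift.
    - intros t. auto_derive; [trivial|ring].
    - intros t. auto_derive; [trivial|ring].
    - intros t. auto_derive; [trivial|ring]. }
  assert (JS' : jet (fun r t => shift_cos k r t * (speed k r t - 1))
    (fun _ => 0) (fun t => 2 * cos t)
    (fun t => (8 * INR m + 2) * (cos t ^ 2 - sin t ^ 2))).
  { apply (jet_is_derive _ _ _ _ _ _ _ _ JS).
    - intros r t Hr. now apply is_derive_shift.
    - intros t. auto_derive; [trivial|ring].
    - intros t. auto_derive; [trivial|ring].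
    - intros t. auto_derive; [trivial|ring]. }
  refine (jet_ext _ _ _ _ _ _ _ _
    (jet_plus _ _ _ _ _ _ _ _ (jet_const 1)
      (jet_minus _ _ _ _ _ _ _ _ (jet_mult _ _ _ _ _ _ _ _ JC JS')
        (jet_mult _ _ _ _ _ _ _ _ JS JC'))) _ _ _ _);
    try (intros; cbv beta; ring).
  intros r t Hr. cbv beta.
  pose proof (sin2_cos2 (lift r k t - t)) as T. unfold Rsqr in T.
  fold (shift_cos k r t) (shift_sin k r t) in T.
  transitivity (1 + (shift_sin k r t * shift_sin k r t
    + shift_cos k r t * shift_cos k r t) * (speed k r t - 1)); [ring|].
  rewrite T. ring.
Qed.

Lemma is_derive_speed m r t : small r ->
  is_derive (speed (2 * m + 1) r) t (accel (2 * m + 1) r t).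
Proof.
  intros Hr. apply Derive_correct.
  apply nice_ex_derive; [|exact Hr]. eapply jet_nice, jet_speed.
Qed.

Lemma jet_accel m :
  jet (accel (2 * m + 1)) (fun _ => 0) (fun t => 2 * sin t)
    (fun t => 4 * (8 * INR m + 2) * (sin t * cos t)).
Proof.
  apply (jet_is_derive _ _ _ _ _ _ _ _ (jet_speed m)).
  - intros. now apply is_derive_speed.
  - intros t. auto_derive; [trivial|ring].
  - intros t. auto_derive; [trivial|ring].
  - intros t. auto_derive; [trivial|ring].
Qed.

(** This is L, with [d] standing for F - t. It sees [d] only through cosine and sine, the quantities
    expanded above. *)
Definition cusp_fun (d f' f'' : R) : R := f' * (1 + f') * sin d - f'' * (1 - cos d).

Definition cusp_family (k : nat) (r t : R) : R :=
  cusp_fun (lift r k t - t) (speed k r t) (accel k r t).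

(** At order r the two products give 2 (2 sin t) - (2 sin t) 2 = 0. At order r^2 the coefficient of
    sin t cos t is - 12 + 2 (8m + 2) - 8 (8m + 2) = - 24 (2m + 1). *)
Lemma jet_cusp_family m :
  jet (cusp_family (2 * m + 1)) (fun _ => 0) (fun _ => 0)
    (fun t => - 24 * (2 * INR m + 1) * (sin t * cos t)).
Proof.
  destruct (jet_shift_odd m) as [JC JS].
  pose proof (jet_speed m) as JV. pose proof (jet_accel m) as JA.
  refine (jet_ext _ _ _ _ _ _ _ _
    (jet_minus _ _ _ _ _ _ _ _
      (jet_mult _ _ _ _ _ _ _ _
        (jet_mult _ _ _ _ _ _ _ _ JV
          (jet_plus _ _ _ _ _ _ _ _ (jet_const 1) JV)) JS)
      (jet_mult _ _ _ _ _ _ _ _ JA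
        (jet_minus _ _ _ _ _ _ _ _ (jet_const 1) JC))) _ _ _ _);
    intros; cbv beta; try ring.
  reflexivity.
Qed.

Lemma jet_Derive_cusp_family m :
  jet (fun r => Derive (cusp_family (2 * m + 1) r)) (fun _ => 0) (fun _ => 0)
    (fun t => - 24 * (2 * INR m + 1) * (cos t ^ 2 - sin t ^ 2)).
Proof.
  apply (jet_is_derive _ _ _ _ _ _ _ _ (jet_cusp_family m)).
  - intros. apply Derive_correct, nice_ex_derive; [|assumption].
    eapply jet_nice, jet_cusp_family.
  - intros t. auto_derive; [trivial|ring].
  - intros t. auto_derive; [trivial|ring].
  - intros t. auto_derive; [trivial|ring].
Qed.

(** The lift is unbounded in t, hence not [nice]; orders 0 and 1 are direct, and higher orders come
    from its [nice] derivative with the order shifted by one. *)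
Lemma ex_derive_n_lift m r n t : small r -> ex_derive_n (lift r (2 * m + 1)) n t.
Proof.
  intros Hr. destruct n as [|[|n]]; [exact I|now apply ex_derive_lift|].
  pose proof (nice_ex_derive_n (S n) _ (jet_nice _ _ _ _ (jet_speed m)) r t Hr) as H.
  unfold speed in H. set (f := lift r (2 * m + 1)) in *.
  change (ex_derive (Derive_n (Derive f) n) t) in H.
  change (ex_derive (Derive_n f (S n)) t).
  apply ex_derive_ext with (2 := H). intros x.
  rewrite <- Nat.add_1_r. apply (Derive_n_comp f n 1 x).
Qed.

(** * The velocity of the caustic and a criterion for cusps *)

(** The sum e^{ia} + e^{ib} is perpendicular to the chord e^{ib} - e^{ia}: it is - i cot((b - a)/2)
    times the chord, and cot(x/2) = sin x / (1 - cos x). *)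
Lemma chord_identities a b :
  (sin a + sin b) * (1 - cos (b - a)) = (cos a - cos b) * sin (b - a) /\
  (cos a + cos b) * (1 - cos (b - a)) = (sin b - sin a) * sin (b - a).
Proof.
  rewrite cos_minus, sin_minus.
  pose proof (sin2_cos2 a) as Ha. pose proof (sin2_cos2 b) as Hb.
  unfold Rsqr in Ha, Hb. split; nsatz.
Qed.

(** The quotient rule gives F'' (e^{it} - e^{iF}) + F' (1 + F') i (e^{it} + e^{iF}) over (1 + F')^2.
    By [chord_identities] the second vector is also a multiple of the chord, so the velocity is
    along the chord, as for an envelope. *)
Lemma is_derive_caustic F F1 F2 t :
  (forall x, is_derive F x (F1 x)) -> is_derive F1 t (F2 t) ->
  1 + F1 t <> 0 -> 1 - cos (F t - t) <> 0 ->
  let l := cusp_fun (F t - t) (F1 t) (F2 t)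
           / ((1 + F1 t) ^ 2 * (1 - cos (F t - t))) in
  is_derive (caustic_x F) t (l * (cos (F t) - cos t)) /\
  is_derive (caustic_y F) t (l * (sin (F t) - sin t)).
Proof.
  intros D1 D2 P Q l.
  assert (E1 : forall x, Derive F x = F1 x) by (intros; now apply is_derive_unique).
  assert (E2 : Derive F1 t = F2 t) by now apply is_derive_unique.
  destruct (chord_identities t (F t)) as [Hs Hc].
  unfold l, cusp_fun; clear l.
  assert (X : ex_derive F t) by (eexists; apply D1).
  assert (X1 : ex_derive F1 t) by (eexists; apply D2).
  assert (U1 : Derive (fun x => F x) t = F1 t) by apply E1.
  assert (U2 : Derive (fun x => F1 x) t = F2 t) by apply E2.
  split.
  - apply is_derive_ext with
      (fun x => (F1 x * cos x + cos (F x)) / (1 + F1 x)).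
    { intros x. unfold caustic_x. now rewrite E1. }
    assert (K : sin t + sin (F t)
      = (cos t - cos (F t)) * sin (F t - t) / (1 - cos (F t - t))).
    { rewrite <- Hs. field. exact Q. }
    auto_derive; [repeat split; assumption|]. rewrite U1, U2.
    transitivity ((F2 t * (cos t - cos (F t))
      - F1 t * (1 + F1 t) * (sin t + sin (F t))) / (1 + F1 t) ^ 2).
    + field. exact P.
    + rewrite K. field. split; assumption.
  - apply is_derive_ext with
      (fun x => (F1 x * sin x + sin (F x)) / (1 + F1 x)).
    { intros x. unfold caustic_y. now rewrite E1. }
    assert (K : cos t + cos (F t)
      = (sin (F t) - sin t) * sin (F t - t) / (1 - cos (F t - t))).
    { rewrite <- Hc. field. exact Q. }
    auto_derive; [repeat split; assumption|]. rewrite U1, U2.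
    transitivity ((F2 t * (sin t - sin (F t))
      + F1 t * (1 + F1 t) * (cos t + cos (F t))) / (1 + F1 t) ^ 2).
    + field. exact P.
    + rewrite K. field. split; assumption.
Qed.

(** [P] selects a side of [t0]; on that side the unit velocity agrees with a pair of functions
    continuous at [t0]. *)
Lemma filterlim_within_pair (P : R -> Prop) (U : R -> C) (g h : R -> R) t0 :
  continuous g t0 -> continuous h t0 ->
  locally t0 (fun t => P t -> U t = (g t, h t)) ->
  filterlim U (within P (locally t0)) (locally ((g t0, h t0) : C)).
Proof.
  intros Hg Hh HU. apply filterlim_locally. intros eps.
  pose proof (proj1 (filterlim_locally g (g t0)) Hg eps) as Bg.
  pose proof (proj1 (filterlim_locally h (h t0)) Hh eps) as Bh.
  unfold within.
  generalize (filter_and _ _ HU (filter_and _ _ Bg Bh)).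
  apply filter_imp. intros t (E & G & H) Pt. rewrite (E Pt). split; assumption.
Qed.

Lemma sign_mult_self s : s = 1 \/ s = -1 -> s * s = 1.
Proof. intros [-> | ->]; ring. Qed.

Lemma unit_scaled (s l a b q : R) : s = 1 \/ s = -1 -> 0 < s * l -> 0 < q ->
  a * a + b * b = q ->
  (l * a / Cmod (l * a, l * b), l * b / Cmod (l * a, l * b))
    = (s * a / sqrt q, s * b / sqrt q).
Proof.
  intros Hs Hl Hq E.
  assert (M : Cmod (l * a, l * b) = s * l * sqrt q).
  { unfold Cmod; simpl fst; simpl snd.
    replace ((l * a) ^ 2 + (l * b) ^ 2) with (((s * l) * (s * l)) * q).
    - rewrite sqrt_mult by nra. rewrite sqrt_square by lra. reflexivity.
    - rewrite <- E. replace ((s * l) * (s * l)) with ((s * s) * (l * l)) by ring.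
      rewrite (sign_mult_self s Hs). ring. }
  rewrite M. pose proof (sqrt_lt_R0 _ Hq).
  destruct Hs as [-> | ->]; f_equal; field; split; lra.
Qed.

Lemma chord_length a b :
  (cos b - cos a) * (cos b - cos a) + (sin b - sin a) * (sin b - sin a)
    = 2 * (1 - cos (b - a)).
Proof.
  rewrite cos_minus.
  pose proof (sin2_cos2 a) as Ha. pose proof (sin2_cos2 b) as Hb.
  unfold Rsqr in Ha, Hb. nsatz.
Qed.

(** The unit velocity is the unit chord times the sign of L. The chord varies continuously and does
    not vanish, so the direction reverses where L changes sign; [s] records whether L increases or
    decreases through 0. *)
Lemma cusp_of_sign_change F F1 F2 (s t0 d : R) :
  (forall t, is_derive F t (F1 t)) -> (forall t, is_derive F1 t (F2 t)) ->
  (forall t, 0 < 1 + F1 t) -> (forall t, 0 < 1 - cos (F t - t)) ->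
  s = 1 \/ s = -1 -> 0 < d ->
  let L t := s * cusp_fun (F t - t) (F1 t) (F2 t) in
  L t0 = 0 -> (forall t, t0 - d < t < t0 -> L t < 0) ->
  (forall t, t0 < t < t0 + d -> 0 < L t) ->
  cusp_at F t0.
Proof.
  intros D1 D2 P Q Hs Hd L L0 Ln Lp.
  assert (V : forall t,
    let l := cusp_fun (F t - t) (F1 t) (F2 t)
             / ((1 + F1 t) ^ 2 * (1 - cos (F t - t))) in
    is_derive (caustic_x F) t (l * (cos (F t) - cos t)) /\
    is_derive (caustic_y F) t (l * (sin (F t) - sin t))).
  { intros t. apply is_derive_caustic; auto;
      [specialize (P t)|specialize (Q t)]; lra. }
  (* [g e] and [h e] are the components of the unit chord multiplied by the sign [e]; the square
     root is the chord length. *)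
  set (g := fun (e t : R) => e * (cos (F t) - cos t) / sqrt (2 * (1 - cos (F t - t)))).
  set (h := fun (e t : R) => e * (sin (F t) - sin t) / sqrt (2 * (1 - cos (F t - t)))).
  assert (U : forall e t, e = 1 \/ e = -1 ->
    0 < e * cusp_fun (F t - t) (F1 t) (F2 t) -> unit_velocity F t = (g e t, h e t)).
  { intros e t He Hl. unfold unit_velocity, velocity.
    destruct (V t) as [Vx Vy].
    rewrite (is_derive_unique _ _ _ Vx), (is_derive_unique _ _ _ Vy).
    cbn [fst snd]. apply unit_scaled; [exact He| | |].
    - unfold Rdiv. rewrite <- Rmult_assoc. apply Rmult_lt_0_compat; [exact Hl|].
      apply Rinv_0_lt_compat, Rmult_lt_0_compat; [apply pow_lt|]; auto.
    - specialize (Q t). lra.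
    - apply chord_length. }
  assert (CF : forall t, ex_derive F t) by (intros t; eexists; apply D1).
  assert (Cg : forall e, continuous (g e) t0).
  { intros e. apply @ex_derive_continuous. unfold g. specialize (CF t0).
    pose proof (Q t0). auto_derive.
    pose proof (sqrt_lt_R0 (2 * (1 - cos (F t0 - t0)))) as Hq.
    unfold Rminus in *. repeat split; auto; lra. }
  assert (Ch : forall e, continuous (h e) t0).
  { intros e. apply @ex_derive_continuous. unfold h. specialize (CF t0).
    pose proof (Q t0). auto_derive.
    pose proof (sqrt_lt_R0 (2 * (1 - cos (F t0 - t0)))) as Hq.
    unfold Rminus in *. repeat split; auto; lra. }
  assert (Z : cusp_fun (F t0 - t0) (F1 t0) (F2 t0) = 0).
  { unfold L in L0. destruct Hs as [-> | ->]; lra. }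
  assert (Hms : - s = 1 \/ - s = -1) by (destruct Hs as [-> | ->]; [right|left]; lra).
  split; [|split; [|split]].
  - rewrite (is_derive_unique _ _ _ (D1 t0)). specialize (P t0). lra.
  - destruct (V t0) as [Vx _]. rewrite Z in Vx. unfold Rdiv in Vx.
    now rewrite !Rmult_0_l in Vx.
  - destruct (V t0) as [_ Vy]. rewrite Z in Vy. unfold Rdiv in Vy.
    now rewrite !Rmult_0_l in Vy.
  (* To the left of [t0] the sign of L is [- s], to the right it is [s]. *)
  - exists (g (- s) t0, h (- s) t0). split; [|split].
    + assert (0 < 2 * (1 - cos (F t0 - t0))) as Hq by (specialize (Q t0); lra).
      pose proof (sqrt_lt_R0 _ Hq). pose proof (sqrt_sqrt _ (Rlt_le _ _ Hq)) as E.
      unfold Cmod, g, h; simpl fst; simpl snd.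
      transitivity (sqrt 1); [f_equal|apply sqrt_1].
      set (q := sqrt _) in *.
      transitivity ((s * s) * (((cos (F t0) - cos t0) * (cos (F t0) - cos t0)
         + (sin (F t0) - sin t0) * (sin (F t0) - sin t0)) / (q * q))).
      * field. lra.
      * rewrite chord_length, E, (sign_mult_self s Hs). field. lra.
    + apply (filterlim_within_pair _ _ (g (- s)) (h (- s))); auto.
      exists (mkposreal d Hd). intros t Ht Hlt.
      apply Rabs_def2 in Ht. simpl in Ht. unfold minus, plus, opp in Ht; simpl in Ht.
      apply U; [exact Hms|].
      specialize (Ln t ltac:(lra)). unfold L in Ln. lra.
    + replace (Copp (g (- s) t0, h (- s) t0)) with ((g s t0, h s t0) : C).
      * apply (filterlim_within_pair _ _ (g s) (h s)); auto.
        exists (mkposreal d Hd). intros t Ht Hlt.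
        apply Rabs_def2 in Ht. simpl in Ht. unfold minus, plus, opp in Ht; simpl in Ht.
        apply U; [exact Hs|].
        specialize (Lp t ltac:(lra)). exact Lp.
      * unfold Copp, g, h; simpl. f_equal; unfold Rdiv; ring.
Qed.

(** * Simple zeros of L near the multiples of pi / 2 *)

Lemma increasing_zero (f f' : R -> R) (a b : R) :
  a < b -> (forall t, is_derive f t (f' t)) ->
  (forall t, a < t < b -> 0 < f' t) -> f a < 0 -> 0 < f b ->
  exists t0 d, 0 < d /\ a < t0 < b /\ f t0 = 0 /\
    (forall t, t0 - d < t < t0 -> f t < 0) /\
    (forall t, t0 < t < t0 + d -> 0 < f t).
Proof.
  intros Hab D Hp Ha Hb.
  assert (Cf : continuity f).
  { intros t. apply continuity_pt_filterlim, (ex_derive_continuous f).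
    eexists; apply D. }
  destruct (IVT f a b Cf Hab Ha Hb) as [t0 [[H1 H2] Z]].
  assert (a <> t0) by (intros E; rewrite <- E in Z; lra).
  assert (t0 <> b) by (intros E; rewrite E in Z; lra).
  assert (I : forall x y, a < x -> x < y -> y < b -> f x < f y).
  { intros x y. apply (incr_function f a b f'); intros; [apply D|apply Hp; split]; auto. }
  exists t0, (Rmin (t0 - a) (b - t0)).
  pose proof (Rmin_l (t0 - a) (b - t0)). pose proof (Rmin_r (t0 - a) (b - t0)).
  split; [apply Rmin_pos; lra|]. split; [lra|]. split; [exact Z|].
  split; intros t Ht; rewrite <- Z; apply I; lra.
Qed.

Lemma cos_sin_shift_PI (j : nat) (x : R) :
  cos (INR j * PI + x) = (-1) ^ j * cos x /\ sin (INR j * PI + x) = (-1) ^ j * sin x.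
Proof.
  induction j as [|j [IC IS]].
  - simpl. rewrite Rmult_0_l, Rplus_0_l. lra.
  - rewrite S_INR. replace ((INR j + 1) * PI + x) with (INR j * PI + x + PI) by ring.
    rewrite neg_cos, neg_sin, IC, IS. simpl. lra.
Qed.

(** After division by r^2, L and its derivative lie within 1 of - N sin t cos t and of its
    derivative. As N is at least 24, this error cannot change the sign of the derivative on the
    interval, nor that of L at the endpoints. The last two bounds give F' > 0 and cos (F - t) < 0,
    so the denominators of the velocity do not vanish. *)
Lemma cusp_near (m j : nat) (r : R) :
  small r ->
  let k := (2 * m + 1)%nat in
  let N := 24 * (2 * INR m + 1) in
  (forall t, Rabs (cusp_family k r t / r ^ 2 - - N * (sin t * cos t)) < 1) ->
  (forall t, Rabs (Derive (cusp_family k r) t / r ^ 2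
                   - - N * (cos t ^ 2 - sin t ^ 2)) < 1) ->
  (forall t, Rabs (speed k r t - 1) < 1) ->
  (forall t, Rabs (shift_cos k r t - -1) < 1) ->
  exists t0, INR j * PI / 2 - PI / 8 < t0 < INR j * PI / 2 + PI / 8 /\
    cusp_at (lift r k) t0.
Proof.
  intros Hr k N B B' BV BC.
  assert (HN : 24 <= N) by (unfold N; pose proof (pos_INR m); lra).
  (* Since sin 2t = e sin (2t - j pi), multiplying L by [- e] makes it increase through its zero
     near j pi / 2 for either parity of j. *)
  set (e := (-1) ^ j).
  assert (He : - e = 1 \/ - e = -1).
  { unfold e. destruct (Nat.Even_or_Odd j) as [[i ->]|[i ->]].
    - rewrite pow_1_even. lra.
    - rewrite Nat.add_1_r, pow_1_odd. lra. }
  assert (Hr2 : 0 < r ^ 2) by (apply pow_lt; apply Hr).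
  assert (H4 : 1 / 2 < cos (PI / 4)).
  { rewrite cos_PI4. pose proof sqrt2_neq_0. pose proof (sqrt_lt_R0 2 ltac:(lra)).
    assert (sqrt 2 < 2) by (rewrite <- (sqrt_square 2) at 2 by lra; apply sqrt_lt_1; lra).
    apply Rmult_lt_compat_l; [lra|]. apply Rinv_lt_contravar; nra. }
  pose proof PI_RGT_0 as HPI.
  set (D := Derive (cusp_family k r)) in *.
  assert (Dl : forall t, is_derive (cusp_family k r) t (D t)).
  { intros t. apply Derive_correct, nice_ex_derive; [|exact Hr].
    eapply jet_nice, jet_cusp_family. }
  assert (V : forall t, cos t ^ 2 - sin t ^ 2 = e * cos (2 * t - INR j * PI) /\
    2 * (sin t * cos t) = e * sin (2 * t - INR j * PI)).
  { intros t. unfold e. destruct (cos_sin_shift_PI j (2 * t - INR j * PI)) as [<- <-].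
    replace (INR j * PI + (2 * t - INR j * PI)) with (2 * t) by ring.
    rewrite cos_2a, sin_2a. split; ring. }
  (* If |x| > 1/8, the main term N |x| exceeds 3 and so dominates the error 1. The lemma is applied
     with x = cos (2t - j pi) > 1/2 for the derivative and x = sin (2t - j pi) / 2, of size above
     1/4, at the endpoints. *)
  assert (Sc : forall x y, Rabs (y / r ^ 2 - - N * (e * x)) < 1 ->
    (1 / 8 < x -> 0 < - e * y) /\ (x < - (1 / 8) -> - e * y < 0)).
  { intros x y Hy. apply Rabs_def2 in Hy.
    assert (E : y = y / r ^ 2 * r ^ 2) by (field; apply Rgt_not_eq, Hr).
    set (z := y / r ^ 2) in *. rewrite E.
    assert (P : forall q, 0 < q -> 0 < q * r ^ 2)
      by (intros; now apply Rmult_lt_0_compat).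
    assert (Ee : e = -1 \/ e = 1) by lra.
    split; intros Hx.
    - assert (P1 : 0 < - e * z) by (destruct Ee as [-> | ->]; nra).
      apply P in P1. lra.
    - assert (P1 : 0 < e * z) by (destruct Ee as [-> | ->]; nra).
      apply P in P1. lra. }
  assert (E4 : sin (PI / 4) = cos (PI / 4)) by now rewrite sin_PI4, cos_PI4.
  destruct (increasing_zero (fun t => - e * cusp_family k r t)
    (fun t => - e * D t) (INR j * PI / 2 - PI / 8) (INR j * PI / 2 + PI / 8))
    as (t0 & d & Hd & It & Z & Ln & Lp).
  - lra.
  - intros t. apply is_derive_scal. apply Dl.
  - intros t Ht.
    assert (cos (PI / 4) < cos (2 * t - INR j * PI)).
    { destruct (Rle_dec 0 (2 * t - INR j * PI)).
      - apply cos_decreasing_1; lra.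
      - rewrite <- (cos_neg (2 * t - INR j * PI)). apply cos_decreasing_1; lra. }
    specialize (B' t). rewrite (proj1 (V t)) in B'.
    apply (proj1 (Sc _ _ B')). lra.
  - set (t := INR j * PI / 2 - PI / 8) in *. specialize (B t).
    replace (sin t * cos t) with (e * (sin (2 * t - INR j * PI) / 2)) in B
      by (pose proof (proj2 (V t)); lra).
    replace (2 * t - INR j * PI) with (- (PI / 4)) in B by (unfold t; field).
    rewrite sin_neg, E4 in B. apply (proj2 (Sc _ _ B)). lra.
  - set (t := INR j * PI / 2 + PI / 8) in *. specialize (B t).
    replace (sin t * cos t) with (e * (sin (2 * t - INR j * PI) / 2)) in B
      by (pose proof (proj2 (V t)); lra).
    replace (2 * t - INR j * PI) with (PI / 4) in B by (unfold t; field).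
    rewrite E4 in B. apply (proj1 (Sc _ _ B)). lra.
  - exists t0. split; [exact It|].
    apply (cusp_of_sign_change _ (speed k r) (accel k r) (- e) t0 d); auto.
    + intros t. now apply is_derive_lift.
    + intros t. now apply is_derive_speed.
    + intros t. specialize (BV t). apply Rabs_def2 in BV. lra.
    + intros t. specialize (BC t). apply Rabs_def2 in BC.
      unfold shift_cos in BC. lra.
Qed.

(** * Choice of the threshold and four distinct cusps *)

Lemma circle_pt_neq a b : a < b < a + 2 * PI -> circle_pt a <> circle_pt b.
Proof.
  intros H E. apply circle_pt_eq in E. destruct E as [E1 E2].
  pose proof (chord_length a b) as Cl. rewrite E1, E2 in Cl.
  replace (b - a) with (2 * ((b - a) / 2)) in Cl by field.
  rewrite cos_2a_sin in Cl.
  assert (0 < sin ((b - a) / 2)) by (apply sin_gt_0; lra). nra.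
Qed.

(** [K] gathers the other summands of a common denominator, so that one threshold on r serves
    several constants. *)
Lemma mult_lt_1_of_lt_inv M K r :
  0 < r < / (Rabs M + K + 1) -> 0 <= K -> M * r < 1.
Proof.
  intros [H0 H1] HK. pose proof (Rabs_pos M). pose proof (Rle_abs M).
  apply Rle_lt_trans with ((Rabs M + K + 1) * r); [nra|].
  apply Rmult_lt_compat_l with (r := Rabs M + K + 1) in H1; [|lra].
  rewrite Rinv_r in H1; lra.
Qed.

Theorem theorem3p3 :
  forall m : nat, exists rm : R, 0 < rm /\
    forall r : R, 0 < r < rm ->
      exists l : list S1,
        NoDup l /\ (4 <= length l)%nat /\
        forall z : S1, In z l -> is_cusp (Nat.iter (2 * m + 1) (reflection r)) z.
Proof.
  intros m.
  destruct (jet_bound_2 _ _ (jet_cusp_family m)) as [M1 B1].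
  destruct (jet_bound_2 _ _ (jet_Derive_cusp_family m)) as [M2 B2].
  destruct (jet_bound_0 _ _ _ _ (jet_speed m)) as [M3 B3].
  destruct (jet_bound_0 _ _ _ _ (proj1 (jet_shift_odd m))) as [M4 B4].
  pose proof (Rabs_pos M1). pose proof (Rabs_pos M2).
  pose proof (Rabs_pos M3). pose proof (Rabs_pos M4).
  (* The four absolute values make every error bound M_i r less than 1; the extra 1 + 1 forces r <
     1/2. *)
  exists (/ (Rabs M1 + Rabs M2 + Rabs M3 + Rabs M4 + 1 + 1)).
  split; [apply Rinv_0_lt_compat; lra|].
  intros r Hr.
  assert (K : forall M, Rabs M <= Rabs M1 + Rabs M2 + Rabs M3 + Rabs M4 -> M * r < 1).
  { intros M HM.
    apply mult_lt_1_of_lt_inv with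
      (Rabs M1 + Rabs M2 + Rabs M3 + Rabs M4 - Rabs M + 1); [|lra].
    replace (Rabs M + _ + 1) with (Rabs M1 + Rabs M2 + Rabs M3 + Rabs M4 + 1 + 1) by ring.
    exact Hr. }
  assert (Hs : small r).
  { split; [lra|].
    assert (2 * r < 1); [|lra].
    destruct Hr as [Hr0 Hr1].
    set (W := Rabs M1 + Rabs M2 + Rabs M3 + Rabs M4 + 1 + 1) in *.
    apply Rmult_lt_compat_l with (r := W) in Hr1; [|unfold W; lra].
    rewrite Rinv_r in Hr1 by (unfold W; lra). unfold W in Hr1. nra. }
  assert (Cusp : forall j, exists t0,
    INR j * PI / 2 - PI / 8 < t0 < INR j * PI / 2 + PI / 8 /\
    cusp_at (lift r (2 * m + 1)) t0).
  { intros j. apply cusp_near; [exact Hs| | | |]; intros t.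
    - eapply Rle_lt_trans; [|apply (K M1); lra].
      replace (- (24 * (2 * INR m + 1))) with (-24 * (2 * INR m + 1)) by ring. auto.
    - eapply Rle_lt_trans; [|apply (K M2); lra].
      replace (- (24 * (2 * INR m + 1))) with (-24 * (2 * INR m + 1)) by ring. auto.
    - eapply Rle_lt_trans; [|apply (K M3); lra]. auto.
    - eapply Rle_lt_trans; [|apply (K M4); lra]. auto. }
  assert (Is : forall t, cusp_at (lift r (2 * m + 1)) t ->
    is_cusp (Nat.iter (2 * m + 1) (reflection r)) (circle_pt t)).
  { intros t Ht. exists (lift r (2 * m + 1)), t.
    split; [split|split]; [| |reflexivity|exact Ht].
    - intros n x. now apply ex_derive_n_lift.
    - intros x. now apply iter_reflection_lift. }
  (* The intervals of radius pi / 8 around 0, pi / 2, pi and 3 pi / 2 are disjoint and span a length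
     7 pi / 4 < 2 pi, so the four parameters give distinct points of the circle. *)
  destruct (Cusp 0%nat) as (t0 & I0 & C0), (Cusp 1%nat) as (t1 & I1 & C1),
    (Cusp 2%nat) as (t2 & I2 & C2), (Cusp 3%nat) as (t3 & I3 & C3).
  simpl INR in I0, I1, I2, I3. pose proof PI_RGT_0.
  exists (map circle_pt (t0 :: t1 :: t2 :: t3 :: nil)). split; [|split].
  - pose proof (circle_pt_neq t0 t1 ltac:(lra)). pose proof (circle_pt_neq t0 t2 ltac:(lra)).
    pose proof (circle_pt_neq t0 t3 ltac:(lra)). pose proof (circle_pt_neq t1 t2 ltac:(lra)).
    pose proof (circle_pt_neq t1 t3 ltac:(lra)). pose proof (circle_pt_neq t2 t3 ltac:(lra)).
    repeat constructor; simpl; intuition congruence.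
  - simpl. lia.
  - intros z Hz. apply in_map_iff in Hz. destruct Hz as (t & <- & Ht).
    apply Is. simpl in Ht. intuition congruence.
Qed.
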